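(* Let $\mathbb{X}$ and $\mathbb{Y}$ be Hausdorff topological spaces, let $\Phi:\mathbb{X}\to 2^{\mathbb{Y}}\setminus\{\emptyset\}$ be a set-valued mapping, let $u:\mathrm{Gr}_{\mathbb{X}}(\Phi)\subseteq\mathbb{X}\times\mathbb{Y}\to\overline{\mathbb{R}}$, and let $x\in\mathbb{X}$. If the function $u$ is $\mathbb{K}\mathbb{N}$-inf-compact on $\mathrm{Gr}_{\{x\}}(\Phi)$, then the value function $v:\mathbb{X}\to\overline{\mathbb{R}}$ is lower semi-continuous at $x$; moreover, $\Phi^*(x)$ is a nonempty compact set if $v(x)<+\infty$, and $\Phi^*(x)=\Phi(x)$ otherwise.
   Context: $\overline{\mathbb{R}}=\mathbb{R}\cup\{\pm\infty\}$. For $Z\subseteq\mathbb{X}$, $\mathrm{Gr}_Z(\Phi)=\{(x,y)\in Z\times\mathbb{Y}: y\in\Phi(x)\}$. The value function is $v(z):=\inf_{y\in\Phi(z)}u(z,y)$, $z\in\mathbb{X}$, and the solution multifunction is $\Phi^*(z):=\{y\in\Phi(z): v(z)=u(z,y)\}$, $z\in\mathbb{X}$. For a nonempty subset $A$ of a Hausdorff topological space $\mathbb{A}$, a function $f:A\subseteq\mathbb{A}\to\overline{\mathbb{R}}$ is lower semi-continuous at $a\in A$ if $\liminf_i f(a_i)\ge f(a)$ for each net $\{a_i\}_{i\in I}\subset A$ converging to $a$ in $\mathbb{A}$. For a nonempty set $Z\subseteq\mathbb{X}$, a function $u:\mathrm{Gr}_{\mathbb{X}}(\Phi)\subseteq\mathbb{X}\times\mathbb{Y}\to\overline{\mathbb{R}}$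 is called $\mathbb{K}\mathbb{N}$-inf-compact on $\mathrm{Gr}_Z(\Phi)$ if: (i) $u:\mathrm{Gr}_{\mathbb{X}}(\Phi)\subseteq\mathbb{X}\times\mathbb{Y}\to\overline{\mathbb{R}}$ is lower semi-continuous at all $(x,y)\in\mathrm{Gr}_Z(\Phi)$; (ii) if a net $\{x_i\}_{i\in I}$ with values in $\mathbb{X}$ converges to $x\in Z$, then each net $\{y_i\}_{i\in I}$, defined on the same index set $I$, with $y_i\in\Phi(x_i)$ for all $i\in I$ and such that the set $\{u(x_i,y_i): i\in I\}$ is bounded above (by a real number), has an accumulation point $y\in\Phi(x)$. *)

(* Defs.v *)
From HB Require Import structures.
From mathcomp Require Import all_boot all_order all_algebra.
From mathcomp Require Import all_classical all_reals all_analysis.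

Set Implicit Arguments.
Unset Strict Implicit.
Unset Printing Implicit Defensive.

Import Order.TTheory GRing.Theory Num.Theory.

Local Open Scope classical_set_scope.
Local Open Scope ring_scope.
Local Open Scope ereal_scope.

(* A net is a function out of a directed index set.  The order on the indices
   is not required to be antisymmetric. *)
Record directed (I : Type) (le : I -> I -> Prop) : Prop := Directed {
  directed_nonempty : inhabited I ;
  directed_refl : forall i, le i i ;
  directed_trans : forall j i k, le i j -> le j k -> le i k ;
  directed_upper : forall i j, exists2 k, le i k & le j k
}.

(* A net [a : I -> T] is handled through the filter [a @ tails le]; [net_cvgP],
   [net_limf_einfE] and [net_clusterP] show that convergence, lower limits and
   accumulation points along it are the usual ones for nets. *)
Definition tails (I : Type) (le : I -> I -> Prop) : set_system I :=
  filter_from [set: I] (fun i => [set j | le i j]).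

Lemma tails_proper (I : Type) (le : I -> I -> Prop) :
  directed le -> ProperFilter (tails le).
Proof.
move=> [[i0] lexx le_trans le_ub]; apply: filter_from_proper; last first.
  by move=> i _; exists i; exact: lexx.
apply: filter_from_filter; first by exists i0.
move=> i j _ _; have [k ik jk] := le_ub i j.
by exists k => // l kl; split; [exact: le_trans ik kl|exact: le_trans jk kl].
Qed.

Lemma net_cvgP (T : topologicalType) (I : Type) (le : I -> I -> Prop)
    (a : I -> T) (t : T) :
  a @ tails le --> t <->
  (forall U, nbhs t U -> exists i, forall j, le i j -> U (a j)).
Proof.
split=> [at_ U /at_ [i _ iU]|at_ U /at_ [i iU]].
  by exists i => j; exact: iU.
by exists i => // j; exact: iU.
Qed.

Lemma net_clusterP (T : topologicalType) (I : Type) (le : I -> I -> Prop)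
    (a : I -> T) (t : T) :
  cluster (a @ tails le) t <->
  (forall U, nbhs t U -> forall i, exists2 j, le i j & U (a j)).
Proof.
split=> [at_ U tU i|at_ A B [i _ iA] /at_ /(_ i) [j ij Bj]].
  have [|_ [[j ij <-] Uj]] := at_ (a @` [set j | le i j]) U _ tU.
    by exists i => // j ij; exists j.
  by exists j.
by exists (a j); split => //; exact: iA.
Qed.

Lemma net_limf_einfE (R : realType) (T : topologicalType) (I : Type)
    (le : I -> I -> Prop) (a : I -> T) (f : T -> \bar R) :
  limf_einf f (a @ tails le) =
  ereal_sup (range (fun i => ereal_inf [set f (a j) | j in [set j | le i j]])).
Proof.
rewrite limf_einfE; apply/eqP; rewrite eq_le; apply/andP; split.
  apply: ge_ereal_sup => _ [V [i _ iV] <-].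
  apply: (@le_trans _ _ (ereal_inf [set f (a j) | j in [set j | le i j]])).
    by apply: ereal_inf_le_tmp => _ [j ij <-]; exists (a j) => //; exact: iV.
  by apply: ereal_sup_ubound; exists i.
apply: ge_ereal_sup => _ [i _ <-]; apply: ereal_sup_ubound.
exists (a @` [set j | le i j]); first by exists i => // j ij; exists j.
by rewrite image_comp.
Qed.

(* The function [f] on the subset [A] is represented by a function on the whole
   space; its values outside [A] are irrelevant when [A a] holds. *)
Definition lsc_at (R : realType) (T : topologicalType) (A : set T)
    (f : T -> \bar R) (a : T) : Prop :=
  forall (I : Type) (le : I -> I -> Prop) (a_ : I -> T),
    directed le -> (forall i, A (a_ i)) ->
    a_ @ tails le --> a -> f a <= limf_einf f (a_ @ tails le).

Definition graph_on (X Y : Type) (Phi : X -> set Y) (Z : set X) : set (X * Y) :=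
  [set p | Z p.1 /\ Phi p.1 p.2].

(* Only the values of [u] on the graph of [Phi] matter here and below. *)
Definition KN_inf_compact (R : realType) (X Y : topologicalType)
    (Phi : X -> set Y) (u : X * Y -> \bar R) (Z : set X) : Prop :=
  (forall p, graph_on Phi Z p -> lsc_at (graph_on Phi [set: X]) u p) /\
  (forall (I : Type) (le : I -> I -> Prop) (x_ : I -> X) (x : X),
    directed le -> x_ @ tails le --> x -> Z x ->
    forall y_ : I -> Y,
      (forall i, Phi (x_ i) (y_ i)) ->
      (exists M : R, forall i, u (x_ i, y_ i) <= M%:E) ->
      exists y, Phi x y /\ cluster (y_ @ tails le) y).

Definition value_function (R : realType) (X Y : Type)
    (Phi : X -> set Y) (u : X * Y -> \bar R) (z : X) : \bar R :=
  ereal_inf [set u (z, y) | y in Phi z].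

Definition solutions (R : realType) (X Y : Type)
    (Phi : X -> set Y) (u : X * Y -> \bar R) (z : X) : set Y :=
  [set y | Phi z y /\ value_function Phi u z = u (z, y)].

(* Main.v *)
(** Both claims reduce to one selection principle: for a net [x_i] converging to
    [x] and [y_i] in [Phi x_i] with [u (x_i, y_i)] bounded above, some
    accumulation point [y] in [Phi x] of [y_i] satisfies [u (x, y) <= b] for
    every eventual upper bound [b] of [u (x_i, y_i)]: pass to a subnet along
    which [y_i] converges to [y] and use lower semi-continuity.  Minimizers come
    from the net of all low enough points of [Phi x], ordered by decreasing
    value of [u]; compactness, from nets of solutions; and a lower limit of [v]
    below some [b < v x] would yield a net of points where [u <= b], hence a
    point of [Phi x] where [u <= b]. *)

Require Import Defs.
From HB Require Import structures.
From mathcomp Require Import all_boot all_order all_algebra.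
From mathcomp Require Import all_classical all_reals all_analysis.

Local Open Scope classical_set_scope.
Local Open Scope ereal_scope.

Import Order.TTheory GRing.Theory Num.Theory.

(** Serves to restrict a directed set to indices carrying a constraint: an upper bound in [I] need
    not come from [K], but cofinality puts some [q m] above it. As [q] need not be injective, the
    pulled-back order may fail antisymmetry. *)
Lemma directed_cofinal (I K : Type) (le : I -> I -> Prop) (q : K -> I) :
  directed le -> (forall i, exists k, le i (q k)) ->
  directed (fun k l => le (q k) (q l)).
Proof.
move=> [[i0] lexx le_trans le_ub] qcof; split.
- by have [k _] := qcof i0; exists.
- by move=> k; exact: lexx.
- by move=> l k m; exact: le_trans.
- move=> k l; have [i ki li] := le_ub (q k) (q l); have [m im] := qcof i.
  by exists m; [exact: le_trans ki im|exact: le_trans li im].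
Qed.

Lemma net_cvg_subnet (T : topologicalType) (I K : Type)
    (le : I -> I -> Prop) (leK : K -> K -> Prop) (q : K -> I)
    (a : I -> T) (t : T) :
  directed le -> (forall k l, leK k l -> le (q k) (q l)) ->
  (forall i, exists k, le i (q k)) ->
  a @ tails le --> t -> (a \o q) @ tails leK --> t.
Proof.
move=> [_ _ le_trans _] qmono qcof /net_cvgP at_.
apply/net_cvgP => U /at_[i iU]; have [k ik] := qcof i.
by exists k => l /qmono kl; apply: iU; exact: le_trans ik kl.
Qed.

Lemma directed_prod (I J : Type) (leI : I -> I -> Prop) (leJ : J -> J -> Prop) :
  directed leI -> directed leJ ->
  directed (fun p q : I * J => leI p.1 q.1 /\ leJ p.2 q.2).
Proof.
move=> [[i0] Ixx Itr Iub] [[j0] Jxx Jtr Jub]; split.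
- by exists.
- by move=> [i j]; split; [exact: Ixx|exact: Jxx].
- move=> p q r [pq1 pq2] [qr1 qr2].
  by split; [exact: Itr pq1 qr1|exact: Jtr pq2 qr2].
- move=> [i j] [i' j']; have [k ik i'k] := Iub i i'.
  by have [l jl j'l] := Jub j j'; exists (k, l).
Qed.

(** Used for the neighbourhoods of a point and for the filter in the compactness proof;
    intersections give upper bounds. *)
Lemma directed_filter (T : Type) (F : set_system T) :
  Filter F -> directed (fun A B : {A : set T | F A} => sval B `<=` sval A).
Proof.
move=> FF; split.
- by exists; exists setT; exact: filterT.
- by move=> A.
- by move=> B A C AB BC; exact: subset_trans BC AB.
- move=> [A FA] [B FB]; exists (exist _ (A `&` B) (filterI FA FB)) => /=.
    exact: subIsetl.
  exact: subIsetr.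
Qed.

Lemma net_cluster_subnet (T : topologicalType) (I : Type)
    (le : I -> I -> Prop) (a : I -> T) (t : T) :
  directed le -> cluster (a @ tails le) t ->
  exists (K : Type) (leK : K -> K -> Prop) (q : K -> I),
    [/\ directed leK,
        forall k l, leK k l -> le (q k) (q l),
        forall i, exists k, le i (q k)
      & (a \o q) @ tails leK --> t].
Proof.
move=> dle /net_clusterP at_; have dN := directed_filter _ _ (nbhs_filter t).
have dP := directed_prod _ _ _ _ dle dN.
(* Indices are pairs [(i, U)] with [a i] in the neighbourhood [U] of [t]; accumulation at [t] makes
   them cofinal among all pairs. *)
pose K := {p : I * {U : set T | nbhs t U} | sval p.2 (a p.1)}.
have Kcof (p : I * {U : set T | nbhs t U}) : exists k : K,
    le p.1 (sval k).1 /\ sval (sval k).2 `<=` sval p.2.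
  have [j ij pj] := at_ _ (svalP p.2) p.1.
  by exists (exist _ (j, p.2) pj); split.
exists K, (fun k l => le (sval k).1 (sval l).1 /\
  sval (sval l).2 `<=` sval (sval k).2), (fun k => (sval k).1); split.
- exact: directed_cofinal dP Kcof.
- by move=> k l [].
- by move=> i; have [k [ik _]] := Kcof (i, exist _ setT filterT); exists k.
- apply/net_cvgP => U tU; have [i0] := directed_nonempty dle.
  have [k [_ kU]] := Kcof (i0, exist _ U tU).
  by exists k => l [_ lk]; apply: kU; apply: lk; exact: svalP l.
Qed.

Lemma net_limf_einf_le (R : realType) (T : topologicalType) (I : Type)
    (le : I -> I -> Prop) (a : I -> T) (f : T -> \bar R) (b : \bar R) :
  directed le -> (exists i, forall j, le i j -> f (a j) <= b) ->
  limf_einf f (a @ tails le) <= b.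
Proof.
move=> [_ _ _ le_ub] [i ib]; rewrite net_limf_einfE.
apply: ge_ereal_sup => _ [j _ <-]; have [k ik jk] := le_ub i j.
by apply: le_trans (ib k ik); apply: ereal_inf_lbound; exists k.
Qed.

(** Inf-compactness asks for a real upper bound, while the values compared may be infinite. *)
Lemma lte_fin_between (R : realType) (a c : \bar R) :
  a < c -> exists b : R, a < b%:E < c.
Proof.
case: a c => [a||] [c||]// ac.
- by exists ((a + c) / 2)%R; rewrite !lte_fin !midf_lt.
- by exists (a + 1)%R; rewrite lte_fin ltrDl ltr01 ltry.
- by exists (c - 1)%R; rewrite lte_fin gtrDl ltrN10 ltNyr.
- by exists 0%R; rewrite ltNyr ltry.
Qed.

Section KN_inf_compact_at.
Context (R : realType) (X Y : topologicalType).
Context (Phi : X -> set Y) (u : X * Y -> \bar R) (x : X).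
Hypothesis u_KN : KN_inf_compact Phi u [set x].

Local Notation v := (value_function Phi u).

Lemma value_function_le z y : Phi z y -> v z <= u (z, y).
Proof. by move=> zy; apply: ereal_inf_lbound; exists y. Qed.

(** The point [y] is chosen before [b], so that one [y] serves all eventual bounds at once; the
    existence of a minimizer relies on this. *)
Lemma KN_inf_compact_selection (I : Type) (le : I -> I -> Prop)
    (x_ : I -> X) (y_ : I -> Y) (M : R) :
  directed le -> x_ @ tails le --> x -> (forall i, Phi (x_ i) (y_ i)) ->
  (forall i, u (x_ i, y_ i) <= M%:E) ->
  exists y, [/\ Phi x y, cluster (y_ @ tails le) y
    & forall b, (exists i, forall j, le i j -> u (x_ j, y_ j) <= b) ->
        u (x, y) <= b].
Proof.
move=> dle x_x Phixy uM; have [u_lsc u_cpt] := u_KN.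
have [y [Phiy yy]] := u_cpt I le x_ x dle x_x erefl y_ Phixy
  (ex_intro _ M uM).
exists y; split=> // b [i ib].
have [K [leK [q [dK qmono qcof yq]]]] :=
  net_cluster_subnet _ _ _ _ _ dle yy.
pose p_ k := (x_ (q k), y_ (q k)).
have p_xy : p_ @ tails leK --> (x, y).
  have tailsK_proper := tails_proper dK.
  apply: cvg_pair; last exact: yq.
  exact: net_cvg_subnet dle qmono qcof x_x.
have p_graph k : graph_on Phi [set: X] (p_ k) by split=> //; exact: Phixy.
have xy_graph : graph_on Phi [set x] (x, y) by [].
apply: le_trans (u_lsc (x, y) xy_graph K leK p_ dK p_graph p_xy) _.
apply: net_limf_einf_le dK _; have [k ik] := qcof i; exists k => l kl.
by apply: ib; exact: directed_trans dle _ _ _ ik (qmono _ _ kl).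
Qed.

Lemma solutions_nonempty : v x < +oo -> solutions Phi u x !=set0.
Proof.
move=> /ereal_inf_lt[_ [y0 Phiy0 <-] uy0].
have [M /andP[/ltW uM _]] := lte_fin_between _ _ _ uy0.
pose K := {y | Phi x y /\ u (x, y) <= M%:E}.
(* Later indices have smaller values; upper bounds exist because the order on [\bar R] is total. *)
pose leK (k l : K) : Prop := u (x, sval l) <= u (x, sval k).
have dK : directed leK.
  split; first by exists; exists y0.
  - by move=> k; exact: lexx.
  - by move=> l k m kl lm; exact: le_trans lm kl.
  - move=> k l; have [kl|/ltW lk] := leP (u (x, sval k)) (u (x, sval l)).
      by exists k; [exact: lexx|].
    by exists l; [|exact: lexx].
have [|k|k|y [Phiy _ uy]] :=
  KN_inf_compact_selection K leK (fun=> x) (fun k => sval k) M dK.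
- apply/net_cvgP => U /nbhs_singleton xU.
  by exists (exist _ y0 (conj Phiy0 uM)).
- by case: (svalP k).
- by case: (svalP k).
(* If [u (x, y')] is at most [M], then [y'] is itself an index and bounds [u] on its own tail;
   otherwise the bound [M] suffices. *)
have {}uy y' : Phi x y' -> u (x, y) <= u (x, y').
  move=> Phiy'; have [y'M|/ltW My'] := leP (u (x, y')) M%:E.
    by apply: uy; exists (exist _ y' (conj Phiy' y'M)).
  apply: le_trans My'; apply: uy.
  by exists (exist _ y0 (conj Phiy0 uM)) => -[z []].
exists y; split=> //; apply/eqP; rewrite eq_le value_function_le//=.
by apply: le_ereal_inf_tmp => _ [y' Phiy' <-]; exact: uy.
Qed.

Lemma solutions_compact : v x < +oo -> compact (solutions Phi u x).
Proof.
move=> vx F FF FS; have filterF : Filter F by exact: filter_filter.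
have dF := directed_filter _ F filterF.
have [M /andP[/ltW vM _]] := lte_fin_between _ _ _ vx.
(* The filter [F] becomes a net of solutions [y] tagged with a member [A] of [F] containing them,
   ordered by shrinking [A]. Along it [u] is constantly [v x], so the selected point is again a
   solution. *)
pose K := {p : {A : set Y | F A} * Y | sval p.1 p.2 /\ solutions Phi u x p.2}.
pose leK (k l : K) : Prop := sval (sval l).1 `<=` sval (sval k).1.
have Kcof (A : {A : set Y | F A}) : exists k : K, sval (sval k).1 `<=` sval A.
  have [y [Ay Sy]] := filter_ex (filterI (svalP A) FS).
  by exists (exist _ (A, y) (conj Ay Sy)).
have dK : directed leK := directed_cofinal _ _ _ _ dF Kcof.
have [||k|y [Phiy yy uy]] := KN_inf_compact_selection K leK (fun=> x)
  (fun k => (sval k).2) M dK.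
- apply/net_cvgP => U /nbhs_singleton xU.
  by have [k] := directed_nonempty dK; exists k.
- by move=> k; case: (svalP k) => _ [].
- by case: (svalP k) => _ [_ <-].
exists y; split.
  split=> //; apply/eqP; rewrite eq_le value_function_le//=; apply: uy.
  have [k] := directed_nonempty dK; exists k => l _.
  by case: (svalP l) => _ [_ <-].
(* Past an index whose tag lies inside [A], the net stays in [A] and meets [B]. *)
move=> A B FA yB; have [k kA] := Kcof (exist _ A FA).
have [l kl Bl] := proj1 (net_clusterP _ _ _) yy B yB k.
by exists (sval l).2; split=> //; apply/kA/kl; case: (svalP l).
Qed.

Lemma value_function_lsc : lsc_at [set: X] v x.
Proof.
move=> I le x_ dle _ x_x; rewrite leNgt; apply/negP => /lte_fin_between[b].
rewrite net_limf_einfE => /andP[vb bv].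
pose K := {p : I * Y | Phi (x_ p.1) p.2 /\ u (x_ p.1, p.2) <= b%:E}.
(* The infimum of [v] over each tail is below [b], so some later [x_ j] has [v (x_ j) < b], and the
   infimum defining [v (x_ j)] supplies [y]. *)
have Kcof (i : I) : exists k : K, le i (sval k).1.
  have : ereal_inf [set v (x_ j) | j in [set j | le i j]] < b%:E.
    by apply: le_lt_trans vb; apply: ereal_sup_ubound; exists i.
  move=> /ereal_inf_lt[_ [j ij <-]] /ereal_inf_lt[_ [y Phiy <-] /ltW uyb].
  by exists (exist _ (j, y) (conj Phiy uyb)).
have dK := directed_cofinal _ _ _ _ dle Kcof.
have [|k|k|y [Phiy _ uy]] := KN_inf_compact_selection K _
  (fun k => x_ (sval k).1) (fun k => (sval k).2) b dK.
- exact: net_cvg_subnet dle _ Kcof x_x.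
- by case: (svalP k).
- by case: (svalP k).
have : v x <= b%:E.
  apply: le_trans (value_function_le _ _ Phiy) (uy _ _).
  by have [k] := directed_nonempty dK; exists k => l _; case: (svalP l).
by rewrite leNgt bv.
Qed.

Lemma solutions_pinfty : ~ v x < +oo -> solutions Phi u x = Phi x.
Proof.
move=> /negP; rewrite -leNgt leye_eq => /eqP vx.
apply/seteqP; split=> [y []//|y Phiy]; split=> //.
by apply/eqP; rewrite eq_le value_function_le//= vx leey.
Qed.

End KN_inf_compact_at.

Theorem theorem3 (R : realType) (X Y : topologicalType)
    (X_hausdorff : hausdorff_space X) (Y_hausdorff : hausdorff_space Y)
    (Phi : X -> set Y) (Phi_nonempty : forall z : X, Phi z !=set0)
    (u : X * Y -> \bar R) (x : X)
    (u_KN : KN_inf_compact Phi u [set x]) :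
  lsc_at [set: X] (value_function Phi u) x /\
  (value_function Phi u x < +oo ->
    solutions Phi u x !=set0 /\ compact (solutions Phi u x)) /\
  (~ value_function Phi u x < +oo -> solutions Phi u x = Phi x).
Proof.
split; first exact: value_function_lsc.
split=> [vx|]; last exact: solutions_pinfty.
by split; [exact: solutions_nonempty|exact: solutions_compact].
Qed.
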